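(* Let $n\ge 2$ be an integer with prime factorization $$n=p_1^{\alpha_1}\cdots p_k^{\alpha_k},\qquad p_1<\cdots<p_k \text{ primes},\quad \alpha_i\ge 1.$$ Then $$\mathcal{C}(\mathbb{Z}/n\mathbb{Z})=\varphi(n)$$ if and only if $$\varphi(n)\ge \frac{n}{p_1}-1.$$ Equivalently, $\mathcal{C}(\mathbb{Z}/n\mathbb{Z})=\varphi(n)$ if and only if $$\prod_{i=1}^k\left(1-\frac1{p_i}\right)+\frac1n\ge \frac1{p_1}.$$
   Context: For an element $x$ of a finite group $G$, $\operatorname{ord}(x)$ denotes its order (for $\mathbb{Z}/n\mathbb{Z}$, the additive order). A nonempty subset $S\subseteq G$ is called a Chowla set if $\operatorname{ord}(x)>|S|$ for every $x\in S$. Define $\mathcal{C}(G)=\max\{|S|:S\subseteq G\text{ is a Chowla set}\}$. $\varphi$ is Euler's totient function. *)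

(* Defs.v *)
From HB Require Import structures.
From mathcomp Require Import all_boot all_order all_algebra all_fingroup.

Set Implicit Arguments.
Unset Strict Implicit.
Unset Printing Implicit Defensive.

(* [#[x]] is the order of x for the group law of gT; on ['Z_n] the group law  *)
(* is addition, so there it is the additive order.                            *)
Definition chowla_set (gT : finGroupType) (S : {set gT}) : bool :=
  (S != set0) && [forall x in S, (#|S| < #[x]%g)%N].

(* The value is 0 when gT has no Chowla set, i.e. when gT is trivial.         *)
Definition chowla_number (gT : finGroupType) : nat :=
  \max_(S : {set gT} | chowla_set S) #|S|.

(* Main.v *)
Require Import Defs.
From HB Require Import structures.
From mathcomp Require Import all_boot all_order all_algebra all_fingroup.
From mathcomp Require Import cyclic ring.

Set Implicit Arguments.
Unset Strict Implicit.
Unset Printing Implicit Defensive.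

Import Order.TTheory GRing.Theory Num.Theory.
Local Open Scope ring_scope.

(** In a cyclic group of order n > 1 exactly totient n elements have order n,
    and every other order is a proper divisor of n, hence at most n / q, where
    q is the least prime factor of n.  The generators form a Chowla set, since
    totient n < n, so the Chowla number is at least totient n and the question
    is whether a larger Chowla set exists.

    If totient n + 1 >= n / q, then a Chowla set with more than totient n
    elements requires orders above n / q, so it consists of generators, of
    which there are too few.  If totient n + 1 < n / q, then an element of
    order n / q, which exists because the group is cyclic, can be added to the
    generators.  This is [chowla_number_cyclic].

    What remains is arithmetic: the first prime of the given factorization is
    the least prime factor of n ([pdiv_prod_prime_powers]), and Euler's product
    ([totient_prod_prime_powers]) turns the first inequality into the second on
    dividing by n. *)

Lemma leq_chowla_number (gT : finGroupType) (S : {set gT}) :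
  chowla_set S -> (#|S| <= chowla_number gT)%N.
Proof. exact: (@leq_bigmax_cond _ (@chowla_set gT) (fun S => #|S|)). Qed.

Lemma card_order_cyclic (gT : finGroupType) :
  cyclic [set: gT] -> #|[set x : gT | #[x]%g == #|gT|]| = totient #|gT|.
Proof.
case/cyclicP=> a defG; have oa : #[a]%g = #|gT| by rewrite orderE -defG cardsT.
rewrite -oa totient_gen; apply: eq_card => x; rewrite !inE /generator -defG.
by rewrite [RHS]eq_sym eqEcard subsetT cardsT -oa -orderE eqn_leq dvdn_leq //=
  oa -cardsT order_dvdG ?inE.
Qed.

(** Among 0, ..., n - 1 the residue 0 is not coprime to n. *)
Lemma ltn_totient (n : nat) : (1 < n)%N -> (totient n < n)%N.
Proof.
case: n => [|n] // n_gt1; rewrite totient_count_coprime big_nat_recl //.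
rewrite /coprime gcdn0 gtn_eqF // add0n ltnS.
apply: (@leq_trans (\sum_(0 <= i < n) 1));
  first exact/leq_sum/(fun i _ => leq_b1 _).
by rewrite sum_nat_const_nat subn0 muln1.
Qed.

(** The cofactor of a proper divisor is a divisor greater than 1, hence at
    least the smallest prime factor. *)
Lemma proper_dvdn_leq_div_pdiv (d n : nat) :
  (0 < n)%N -> (d %| n)%N -> d != n -> (d <= n %/ pdiv n)%N.
Proof.
move=> n_gt0 d_dv d_neq; have n_eq := divnK d_dv.
rewrite leq_divRL ?pdiv_gt0 // -{2}n_eq mulnC leq_mul2r; apply/orP; right.
apply: pdiv_min_dvd; last by rewrite -{2}n_eq dvdn_mulr.
case: (n %/ d)%N n_eq => [|[|m]] // n_eq.
  by rewrite -n_eq in n_gt0.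
by rewrite mul1n in n_eq; rewrite n_eq eqxx in d_neq.
Qed.

Lemma chowla_number_cyclic (gT : finGroupType) (n := #|gT|) :
    cyclic [set: gT] -> (1 < n)%N ->
  (chowla_number gT = totient n) <-> (n %/ pdiv n <= (totient n).+1)%N.
Proof.
move=> cycG n_gt1; have n_gt0 := ltnW n_gt1.
pose U := [set x : gT | #[x]%g == n].
have cardU : #|U| = totient n := card_order_cyclic cycG.
split=> [chowlaE | small].
  rewrite leqNgt; apply/negP=> large.
  have [a defG] := cyclicP cycG.
  have oa : #[a]%g = n by rewrite orderE -defG cardsT.
  pose b := (a ^+ pdiv n)%g.
  have ob : #[b]%g = (n %/ pdiv n)%N by rewrite orderXdiv oa ?pdiv_dvd.
  have b_notinU : b \notin U.
    by rewrite inE ob neq_ltn ltn_Pdiv // prime_gt1 ?pdiv_prime.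
  have cardS : #|b |: U| = (totient n).+1 by rewrite cardsU1 b_notinU cardU.
  suff /leq_chowla_number : chowla_set (b |: U).
    by rewrite cardS chowlaE ltnn.
  apply/andP; split; first by apply/set0Pn; exists b; rewrite setU11.
  apply/forall_inP=> x; rewrite cardS => /setU1P[-> | ]; first by rewrite ob.
  by rewrite inE => /eqP->; apply: leq_trans large (leq_div _ _).
apply/eqP; rewrite eqn_leq; apply/andP; split.
  apply/bigmax_leqP=> S /andP[_ /forall_inP chowlaS].
  rewrite leqNgt; apply/negP=> largeS; suff sSU : S \subset U.
    by move: (subset_leq_card sSU); rewrite cardU leqNgt largeS.
  apply/subsetP=> x /chowlaS ltSx; rewrite inE; apply: contraLR ltSx => ox.
  rewrite -leqNgt; apply: leq_trans (leq_trans small largeS).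
  by apply: proper_dvdn_leq_div_pdiv => //; rewrite /n -cardsT order_dvdG ?inE.
rewrite -cardU; apply: leq_chowla_number; apply/andP; split.
  by rewrite -card_gt0 cardU totient_gt0.
by apply/forall_inP=> x; rewrite inE cardU => /eqP->; apply: ltn_totient.
Qed.

Lemma chowla_number_Zn (n : nat) : (1 < n)%N ->
  (chowla_number 'Z_n = totient n) <-> (n %/ pdiv n <= (totient n).+1)%N.
Proof.
move=> n_gt1; have cardZ : #|'Z_n| = n by rewrite card_ord Zp_cast.
have cycZ : cyclic [set: 'Z_n] by apply/cyclicP; exists Zp1; apply: Zp_cycle.
by have := chowla_number_cyclic cycZ; rewrite cardZ; apply.
Qed.

Lemma coprime_prod_prime_powers (I : eqType) (r : seq I) (p alpha : I -> nat)
    (q : nat) :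
    prime q -> (forall i, i \in r -> prime (p i) /\ p i != q) ->
  coprime q (\prod_(i <- r) p i ^ alpha i).
Proof.
move=> q_pr p_r; rewrite prime_coprime // Euclid_dvd_prod //.
rewrite big_has; apply/hasPn=> i /p_r[pi_pr pi_neq].
by rewrite Euclid_dvdX // dvdn_prime2 // eq_sym (negPf pi_neq).
Qed.

(** Euler's product; [totient] is multiplicative and
    totient (p ^ e) = p ^ e - p ^ (e - 1). *)
Lemma totient_prod_prime_powers (F : numFieldType) (I : eqType) (r : seq I)
    (p alpha : I -> nat) :
    uniq r -> injective p -> (forall i, prime (p i)) ->
    (forall i, (0 < alpha i)%N) ->
  (totient (\prod_(i <- r) p i ^ alpha i))%:R =
    (\prod_(i <- r) p i ^ alpha i)%N%:R * \prod_(i <- r) (1 - 1 / (p i)%:R) :> F.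
Proof.
move=> + p_inj p_pr a_gt0; elim: r => [|i r IHr] /=.
  by rewrite !big_nil mulr1.
case/andP=> i_notin /IHr {}IHr; rewrite !big_cons totient_coprime; last first.
  apply/coprimeXl/coprime_prod_prime_powers => // j j_r; split=> //.
  by rewrite (inj_eq p_inj); apply: contraNneq i_notin => <-.
rewrite totient_pfactor // natrM IHr -[in RHS](prednK (a_gt0 i)) expnS !natrM.
have p_neq0 : (p i)%:R != 0 :> F by rewrite pnatr_eq0 -lt0n prime_gt0.
by rewrite -subn1 natrB ?prime_gt0 //; field.
Qed.

Lemma pdiv_prod_prime_powers (k : nat) (p alpha : 'I_k.+1 -> nat) :
    (forall i, prime (p i)) -> (forall i, (p ord0 <= p i)%N) ->
    (0 < alpha ord0)%N ->
  pdiv (\prod_(i < k.+1) p i ^ alpha i) = p ord0.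
Proof.
move=> p_pr p_min a0_gt0; set n := \prod_(i < _) _.
have p0_dvd : (p ord0 %| n)%N.
  by rewrite /n big_ord_recl dvdn_mulr // dvdn_exp.
have n_gt1 : (1 < n)%N.
  apply: leq_trans (prime_gt1 (p_pr ord0)) (dvdn_leq _ p0_dvd).
  by rewrite prodn_gt0 // => i; rewrite expn_gt0 prime_gt0.
have q_pr := pdiv_prime n_gt1.
apply/eqP; rewrite eqn_leq pdiv_min_dvd ?prime_gt1 //=.
have := pdiv_dvd n; rewrite {2}/n Euclid_dvd_prod // big_has.
case/hasP=> i _; rewrite Euclid_dvdX // dvdn_prime2 // => /andP[/eqP-> _].
exact: p_min.
Qed.

Theorem proposition2p6 (n k : nat) (p alpha : 'I_k.+1 -> nat)
    (hn : (2 <= n)%N)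
    (hprime : forall i, prime (p i))
    (hlt : forall i j : 'I_k.+1, (i < j)%N -> (p i < p j)%N)
    (halpha : forall i, (1 <= alpha i)%N)
    (hfact : n = (\prod_(i < k.+1) p i ^ alpha i)%N) :
  (chowla_number 'Z_n = totient n <->
     (totient n)%:R >= n%:R / (p ord0)%:R - 1 :> rat)
  /\
  (chowla_number 'Z_n = totient n <->
     \prod_(i < k.+1) (1 - 1 / (p i)%:R) + 1 / n%:R >= 1 / (p ord0)%:R :> rat).
Proof.
have p_min i : (p ord0 <= p i)%N.
  have [i0 | i_gt0] := posnP i; last exact/ltnW/hlt.
  by rewrite (_ : i = ord0) //; apply/val_inj.
have p_inj : injective p.
  move=> i j pij; apply/val_inj; have [lt_ij | lt_ji | //] := ltngtP i j.
    by have := hlt _ _ lt_ij; rewrite pij ltnn.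
  by have := hlt _ _ lt_ji; rewrite pij ltnn.
have pdivE : pdiv n = p ord0 by rewrite hfact pdiv_prod_prime_powers.
have totE := totient_prod_prime_powers rat (index_enum_uniq _) p_inj hprime halpha.
rewrite -hfact in totE.
have n_gt0 : 0 < n%:R :> rat by rewrite ltr0n ltnW.
have criterion : (n %/ pdiv n <= (totient n).+1)%N =
    (n%:R / (p ord0)%:R - 1 <= (totient n)%:R :> rat).
  by rewrite lerBlDr natr1 -(ler_nat rat) -pdivE natf_div ?pdiv_dvd.
have scaled : (n%:R / (p ord0)%:R - 1 <= (totient n)%:R :> rat) =
    (1 / (p ord0)%:R <= \prod_(i < k.+1) (1 - 1 / (p i)%:R) + 1 / n%:R :> rat).
  rewrite totE lerBlDr -[in RHS](ler_pM2l n_gt0) mulrDr !mul1r.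
  by rewrite divff // gt_eqF.
by rewrite -scaled -criterion; split; apply: chowla_number_Zn.
Qed.
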